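(* Let $r$ be a positive integer. The maps $\Phi_{\mathcal{E}\mathcal{T}}:\mathcal{E}\to\mathcal{T}$, $\Phi_{\mathcal{T}\Pi}:\mathcal{T}\to\Pi$ and $\Phi_{\mathcal{E}\Pi}:\mathcal{E}\to\Pi$ are all bijections, and $\Phi_{\mathcal{E}\mathcal{T}}\circ\Phi_{\mathcal{T}\Pi}\circ\Phi_{\Pi\mathcal{E}}=1$ (the identity map of $\mathcal{E}$, maps being composed from left to right), where $\Phi_{\Pi\mathcal{E}}=\Phi_{\mathcal{E}\Pi}^{-1}$. Furthermore, (a) $\pi_T^2=1$ for all $T\in\mathcal{T}$, and $\pi_T=1$ if and only if $T=[r-1]$; and (b) $\pi_\varepsilon^2=1$ for all $\varepsilon\in\mathcal{E}$, and $\pi_\varepsilon=1$ if and only if $\varepsilon_n=r+1-2n$ for each $n\in[r]$.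
   Context: Fix a positive integer $r$ and write $[r]=\{1,\dots,r\}$, $[r-1]=\{1,\dots,r-1\}$. Let $S_r$ be the symmetric group on $[r]$; permutations and maps act on the right, written as exponents, and are composed from left to right. $\mathcal{T}$ is the set of all subsets of $[r-1]$. $\mathcal{E}$ is the set of all $r$-tuples $\varepsilon=(\varepsilon_1,\dots,\varepsilon_r)\in\mathbb{Z}^r$ with $\varepsilon_1\ge\cdots\ge\varepsilon_r$ such that $\varepsilon_i-\varepsilon_j\ne j-i$ for $1\le i<j\le r$, and $1-n\le\varepsilon_n\le r-n$ for $1\le n\le r$. For $1\le i\le j\le r$, the reversal $\mathrm{Rev}(i,j)\in S_r$ sends $n$ to $i+j-n$ for $i\le n\le j$ and fixes all other $n\in[r]$. For $T=\{t_1<\cdots<t_{|T|}\}\in\mathcal{T}$, put $t_0:=0$, $t_{|T|+1}:=r$ and $\pi_T=\prod_{i=0}^{|T|}\mathrm{Rev}(t_i+1,t_{i+1})\in S_r$. Let $\Pi:=\{\pi_T\mid T\in\mathcal{T}\}$. For $\varepsilon\in\mathcal{E}$, $\pi_\varepsilon:[r]\to[r]$ is defined by $n^{\pi_\varepsilon}=r+1-n-\varepsilon_n$ for $n\in[r]$; it is a permutation of $[r]$ lying in $\Pi$. The maps are: $\Phi_{\mathcal{E}\mathcal{T}}:\varepsilon\mapsto T_\varepsilon=\{t\in[r-1]\mid\varepsilon_t>\varepsilon_{t+1}\}$; $\Phi_{\mathcal{T}\Pi}:T\mapsto\pi_T$; $\Phi_{\mathcal{E}\Pi}:\varepsilon\mapsto\pi_\varepsilon$.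 *)

(* Defs.v *)
From HB Require Import structures.
From mathcomp Require Import all_boot all_order all_algebra all_fingroup.
From mathcomp Require Import zify.

Set Implicit Arguments.
Unset Strict Implicit.
Unset Printing Implicit Defensive.

Import Order.TTheory GRing.Theory Num.Theory.

Local Open Scope ring_scope.

(* Index convention: the integer n of [r] = {1, ..., r} is the ordinal of     *)
(* 'I_r whose value is n - 1, and likewise for [r - 1] and 'I_r.-1; so        *)
(* S_r is 'S_r, whose product also composes from left to right, and the       *)
(* integer denoted by an ordinal n is n.+1 in every formula below.            *)

Definition calT (r : nat) := {set 'I_r.-1}.

Definition is_epsilon (r : nat) (e : {ffun 'I_r -> int}) : bool :=
  [&& [forall i : 'I_r, forall j : 'I_r, (i <= j)%N ==> (e j <= e i)],
      [forall i : 'I_r, forall j : 'I_r,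
         (i < j)%N ==> (e i - e j != (j.+1)%:Z - (i.+1)%:Z)]
    & [forall n : 'I_r, 1 - (n.+1)%:Z <= e n <= r%:Z - (n.+1)%:Z]].

Definition calE (r : nat) := {e : {ffun 'I_r -> int} | is_epsilon e}.

(* [Rev r i j] takes 1-based integers i and j. The image i + j - (n + 1) of   *)
(* the point n + 1 has ordinal value (i - 1) + j - (n + 1). The default value *)
(* of insubd is only reached when j > r, which makes [Rev] total; see RevE.   *)
Definition Rev_fun (r i j : nat) (n : 'I_r) : 'I_r :=
  insubd n (if (i <= n.+1 <= j)%N then (i.-1 + j - n.+1)%N else n).

Lemma Rev_funK (r i j : nat) : involutive (@Rev_fun r i j).
Proof.
move=> n; apply: val_inj; rewrite /Rev_fun !val_insubd.
have := ltn_ord n; rewrite /=; move: (nat_of_ord n) => m.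
by repeat case: ifP; lia.
Qed.

Definition Rev (r i j : nat) : 'S_r := perm (inv_inj (@Rev_funK r i j)).

Lemma RevE (r i j : nat) (n : 'I_r) : (1 <= i)%N -> (j <= r)%N ->
  (Rev r i j n).+1 = (if (i <= n.+1 <= j)%N then i + j - n.+1 else n.+1)%N.
Proof.
move=> i1 jr; rewrite permE /Rev_fun val_insubd.
have := ltn_ord n; rewrite /=; move: (nat_of_ord n) => m.
by repeat case: ifP; lia.
Qed.

(* 0 = t_0 < t_1 < ... < t_|T| < t_(|T|+1) = r; enum lists ordinals in        *)
(* increasing order.                                                          *)
Definition cuts (r : nat) (T : calT r) : seq nat :=
  0%N :: rcons [seq (nat_of_ord t).+1 | t <- enum T] r.

Definition pi_T (r : nat) (T : calT r) : 'S_r :=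
  (\prod_(i < #|T|.+1)
     Rev r (nth 0%N (cuts T) i).+1 (nth 0%N (cuts T) i.+1))%g.

Definition Pi_set (r : nat) : {set 'S_r} := [set pi_T T | T : calT r].

Definition Pi (r : nat) := {p : 'S_r | p \in Pi_set r}.

(* The entries t and t + 1 of [r], for t in [r - 1].                          *)
Definition ix (r : nat) (t : 'I_r.-1) : 'I_r := widen_ord (leq_pred r) t.

Lemma ix_succ_subproof (r : nat) (t : 'I_r.-1) : (t.+1 < r)%N.
Proof. by case: t => t /=; lia. Qed.

Definition ix_succ (r : nat) (t : 'I_r.-1) : 'I_r :=
  Ordinal (ix_succ_subproof t).

Definition T_eps (r : nat) (e : calE r) : calT r :=
  [set t : 'I_r.-1 | val e (ix t) > val e (ix_succ t)].

Lemma calE_mono (r : nat) (e : calE r) (i j : 'I_r) :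
  (i <= j)%N -> val e j <= val e i.
Proof. by case: e => e /= /and3P[/forallP/(_ i)/forallP/(_ j)/implyP]. Qed.

Lemma calE_neq (r : nat) (e : calE r) (i j : 'I_r) :
  (i < j)%N -> val e i - val e j <> (j.+1)%:Z - (i.+1)%:Z.
Proof.
by case: e => e /= /and3P[_ /forallP/(_ i)/forallP/(_ j)/implyP h _] /h/eqP.
Qed.

Lemma calE_bnd (r : nat) (e : calE r) (n : 'I_r) :
  1 - (n.+1)%:Z <= val e n <= r%:Z - (n.+1)%:Z.
Proof. by case: e => e /= /and3P[_ _ /forallP]. Qed.

Lemma pi_eps_subproof (r : nat) (e : calE r) (n : 'I_r) :
  (`|(r%:Z + 1 - (n.+1)%:Z - val e n)%R|.-1 < r)%N.
Proof. by have := calE_bnd e n; have := ltn_ord n; lia. Qed.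

Definition pi_eps_fun (r : nat) (e : calE r) (n : 'I_r) : 'I_r :=
  Ordinal (pi_eps_subproof e n).

Lemma pi_eps_funE (r : nat) (e : calE r) (n : 'I_r) :
  ((pi_eps_fun e n).+1)%:Z = r%:Z + 1 - (n.+1)%:Z - val e n.
Proof.
have -> : pi_eps_fun e n = `|(r%:Z + 1 - (n.+1)%:Z - val e n)%R|.-1 :> nat by [].
by have := calE_bnd e n; have := ltn_ord n; move: (val e n) => x; lia.
Qed.

Lemma pi_eps_fun_inj (r : nat) (e : calE r) : injective (pi_eps_fun e).
Proof.
move=> i j eij; have := pi_eps_funE e i; have := pi_eps_funE e j.
rewrite eij => -> h; apply: val_inj => /=.
case: (ltngtP i j) => // lij; have := calE_neq (e := e) lij; lia.
Qed.

Definition pi_eps (r : nat) (e : calE r) : 'S_r := perm (@pi_eps_fun_inj r e).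

Lemma pi_epsE (r : nat) (e : calE r) (n : 'I_r) :
  ((pi_eps e n).+1)%:Z = r%:Z + 1 - (n.+1)%:Z - val e n.
Proof. by rewrite permE pi_eps_funE. Qed.

Lemma prod_RevE (r m : nat) (c : nat -> nat) (k : nat) (n : 'I_r) :
    (forall i, (i < m)%N -> (c i < c i.+1)%N) -> (c m <= r)%N ->
    (k < m)%N -> (c k <= n < c k.+1)%N ->
  ((\prod_(i < m) Rev r (c i).+1 (c i.+1))%g n).+1
    = (c k + c k.+1 - n)%N.
Proof.
move=> cS cr km kn.
have cle i j : (i <= j)%N -> (j <= m)%N -> (c i <= c j)%N.
  elim: j => [|j IH]; first by rewrite leqn0 => /eqP->.
  rewrite leq_eqVlt => /orP[/eqP->//|lij] jm.
  by have := IH lij (ltnW jm); have := cS j jm; lia.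
suff H l : (l <= m)%N -> ((\prod_(i < l) Rev r (c i).+1 (c i.+1))%g n).+1
    = (if (k < l)%N then c k + c k.+1 - n else n.+1)%N.
  by rewrite H ?km.
elim: l => [|l IH] lm; first by rewrite big_ord0 perm1.
rewrite big_ord_recr /= permM RevE //; last first.
  by apply: leq_trans cr; apply: cle.
rewrite IH ?(ltnW lm) //.
have clS := cS l lm.
case: (ltngtP k l) => kl.
- have := cle k.+1 l kl (ltnW lm).
  by repeat case: ifP; lia.
- have := cle l.+1 k kl (ltnW km).
  by repeat case: ifP; lia.
- by subst l; repeat case: ifP; lia.
Qed.

Lemma size_cuts (r : nat) (T : calT r) : size (cuts T) = #|T|.+2.
Proof. by rewrite /= size_rcons size_map -cardE. Qed.

Lemma sorted_cuts (r : nat) (T : calT r) : (0 < r)%N -> sorted ltn (cuts T).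
Proof.
move=> r0.
have srt : sorted ltn [seq nat_of_ord t | t <- enum T].
  rewrite sorted_map; apply: (@subseq_sorted _ _ _ _ (enum 'I_r.-1)).
  - by move=> y x z; apply: ltn_trans.
  - by rewrite {1}/enum_mem enumT; exact: filter_subseq.
  - by rewrite -sorted_map val_enum_ord iota_ltn_sorted.
rewrite /cuts /= path_sortedE; last exact: ltn_trans.
apply/andP; split.
  rewrite all_rcons; apply/andP; split; first exact: r0.
  by apply/allP => _ /mapP[t _ ->].
rewrite -cats1 sorted_pairwise; last exact: ltn_trans.
rewrite pairwise_cat /= andbT allrel1r -sorted_pairwise; last exact: ltn_trans.
apply/andP; split.
  by apply/allP => _ /mapP[t _ ->]; have := ltn_ord t; lia.
by rewrite sorted_map; rewrite sorted_map in srt.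
Qed.

Section Cuts.
Variables (r : nat) (T : calT r).
Hypothesis r0 : (0 < r)%N.
Local Notation c := (nth 0%N (cuts T)).

Lemma cutsS (i : nat) : (i < #|T|.+1)%N -> (c i < c i.+1)%N.
Proof.
move=> iT; have := sorted_cuts T r0; rewrite /cuts /= => /(pathP 0%N).
by apply; rewrite size_rcons size_map -cardE.
Qed.

Lemma cuts_last : c #|T|.+1 = r.
Proof. by rewrite /= nth_rcons size_map -cardE ltnn eqxx. Qed.

Lemma cuts_le (i j : nat) : (i <= j)%N -> (j <= #|T|.+1)%N -> (c i <= c j)%N.
Proof.
elim: j => [|j IH]; first by rewrite leqn0 => /eqP->.
rewrite leq_eqVlt => /orP[/eqP->//|lij] jm.
by have := IH lij (ltnW jm); have := cutsS jm; lia.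
Qed.

Lemma cutsP (i : nat) : (i <= #|T|.+1)%N ->
  [\/ c i = 0%N, c i = r | exists2 t, t \in T & c i = t.+1].
Proof.
move=> iT; have : c i \in cuts T by apply: mem_nth; rewrite size_cuts.
rewrite inE mem_rcons inE => /or3P[/eqP->|/eqP->|]; [by constructor 1|by constructor 2|].
by case/mapP => t; rewrite mem_enum => tT ->; constructor 3; exists t.
Qed.

Lemma cuts_block (n : nat) : (n < r)%N ->
  exists2 k, (k < #|T|.+1)%N & (c k <= n < c k.+1)%N.
Proof.
move=> nr; have : (n < c #|T|.+1)%N by rewrite cuts_last.
elim: #|T|.+1 => [|m IH] // nm.
case: (ltnP n (c m)) => nc; first by case: (IH nc) => k /ltnW km; exists k.
by exists m => //; rewrite nc.
Qed.

Lemma cuts_gap (k : nat) (t : 'I_r.-1) : (k < #|T|.+1)%N ->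
  (c k <= t)%N -> (t.+1 < c k.+1)%N -> t \notin T.
Proof.
move=> kT kt tk; apply/negP => tT.
have tc : t.+1 \in cuts T.
  by rewrite inE mem_rcons inE; apply/or3P/Or33/map_f; rewrite mem_enum.
have := nth_index 0%N tc; have := tc; rewrite -index_mem size_cuts ltnS.
move: (index _ _) => m mT em.
by case: (leqP m k) => mk;
   [have := cuts_le mk (ltnW kT)|have := cuts_le mk mT]; rewrite em; lia.
Qed.

End Cuts.

Lemma pi_TE (r : nat) (T : calT r) (k : nat) (n : 'I_r) : (0 < r)%N ->
    (k < #|T|.+1)%N ->
    (nth 0%N (cuts T) k <= n < nth 0%N (cuts T) k.+1)%N ->
  (pi_T T n).+1 = (nth 0%N (cuts T) k + nth 0%N (cuts T) k.+1 - n)%N.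
Proof.
move=> r0 kT kn; apply: prod_RevE kn => //; last by rewrite cuts_last.
by move=> i; apply: cutsS.
Qed.

Lemma discrete_ivt (p : nat -> nat) (a b v : nat) : (a <= b)%N ->
    (forall n, (a <= n < b)%N -> (p n <= (p n.+1).+1)%N) ->
    (p b <= v <= p a)%N ->
  exists2 n, (a <= n <= b)%N & p n = v.
Proof.
elim: b => [|b IH] ab st /andP[h1 h2].
  have a0 : a = 0%N by lia.
  by exists a; [lia | move: h1; rewrite a0 in h2 *; lia].
case: (eqVneq (p b.+1) v) => [ev|/eqP ne]; first by exists b.+1; lia.
case: (eqVneq a b.+1) => [ea|/eqP nab]; first by move: h2; rewrite ea; lia.
have sb : (p b <= (p b.+1).+1)%N by apply: st; lia.
case: IH => [|n hn||n hn en]; [lia | by apply: st; lia | lia |].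
by exists n => //; lia.
Qed.

Section PiEps.
Variables (r : nat) (e : calE r).
Local Notation p := (pi_eps e).

Lemma pi_epsS (i j : 'I_r) : j = i.+1 :> nat -> (p i <= (p j).+1)%N.
Proof.
move=> ji; have := pi_epsE e i; have := pi_epsE e j.
by have := @calE_mono _ e i j; rewrite ji leqnSn => /(_ isT); lia.
Qed.

Lemma pi_eps_ivt (a b v : 'I_r) : (a <= b)%N -> (p b <= v <= p a)%N ->
  exists2 n : 'I_r, (a <= n <= b)%N & p n = v.
Proof.
move=> ab hv; have ar := ltn_ord a.
pose q n : nat := p (insubd a n).
have qE (i : 'I_r) : q i = p i by rewrite /q valKd.
case: (@discrete_ivt q a b v) => // [n hn||n hn qn].
- have br := ltn_ord b.
  by apply: pi_epsS; rewrite !val_insubd; repeat case: ifP; lia.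
- by rewrite !qE.
have nr : (n < r)%N by have := ltn_ord b; lia.
exists (Ordinal nr) => //; apply: val_inj; apply: etrans qn; rewrite /q /=.
by congr (nat_of_ord (p _)); apply: val_inj; rewrite val_insubd nr.
Qed.

Lemma pi_eps_cut (t : 'I_r.-1) (i j : 'I_r) : t \in T_eps e ->
  (i <= t < j)%N -> (p i < p j)%N.
Proof.
rewrite inE => tT /andP[it tj]; rewrite ltnNge; apply/negP => pji.
have inj (x y : 'I_r) : (x < y)%N -> p x <> p y :> nat.
  by move=> xy /val_inj/perm_inj exy; rewrite exy ltnn in xy.
have := inj i j; have := inj (ix t) (ix_succ t) (leqnn _).
have : (p (ix t) <= p (ix_succ t))%N.
  have := pi_epsE e (ix t); have := pi_epsE e (ix_succ t).
  have -> : ix t = t :> nat by []. have -> : ix_succ t = t.+1 :> nat by [].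
  move: tT; move: (val e _) (val e _) => x y; lia.
move=> h1 h2 h3.
case: (leqP (p j) (p (ix t))) => h.
  case: (@pi_eps_ivt (ix_succ t) j (p (ix t))) => [||n hn en]; rewrite ?h //.
  by apply: (inj (ix t) n); rewrite ?en //; move: hn => /=; lia.
case: (@pi_eps_ivt i (ix t) (p j)) => [||n hn en]; rewrite ?(ltnW h) //.
by apply: (inj n j); rewrite ?en //; move: hn => /=; lia.
Qed.

(* A cut point of T_eps e, or an end point, bounds an initial segment that    *)
(* pi_eps e preserves.                                                        *)
Lemma pi_eps_seg (b : nat) (n : 'I_r) :
    [\/ b = 0%N, b = r | exists2 t, t \in T_eps e & b = t.+1] ->
  (p n < b)%N = (n < b)%N.
Proof.
case=> [->|->|[t tT ->]]; first by rewrite !ltn0.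
  by rewrite !ltn_ord.
have tr : (t.+1 < r)%N by exact: ix_succ_subproof.
pose A := [set i : 'I_r | (i < t.+1)%N].
pose B i := [set k : 'I_r | (k < i)%N].
have cB i : (i <= r)%N -> #|B i| = i.
  move=> ir; have inj : injective (widen_ord ir).
    by move=> x y /(congr1 val) /= /val_inj.
  rewrite -[RHS]card_ord -(card_codom inj); apply: eq_card => k; rewrite inE.
  apply/idP/codomP => [ki|[x ->]]; last exact: (ltn_ord x).
  exists (Ordinal ki); exact: val_inj.
have AB : A = B t.+1 by [].
case: (ltnP n t.+1) => nt; last first.
  apply/negbTE; rewrite -leqNgt -(cB t.+1) ?(ltnW tr) // -AB.
  rewrite -(card_imset (mem A) (@perm_inj _ p)) -(cB (p n)) ?(ltnW (ltn_ord _)) //.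
  apply: subset_leq_card; apply/subsetP => _ /imsetP[i iA ->].
  by rewrite inE in iA; rewrite inE; apply: (pi_eps_cut tT); lia.
have : (#|~: A| <= #|~: B (p n).+1|)%N.
  rewrite -(card_imset (mem (~: A)) (@perm_inj _ p)).
  apply: subset_leq_card; apply/subsetP => _ /imsetP[i iA ->].
  rewrite !inE in iA; rewrite !inE -leqNgt; apply: (pi_eps_cut tT); lia.
have := cardsC A; have := cardsC (B (p n).+1).
rewrite AB !cB ?ltn_ord ?(ltnW tr) // card_ord.
by have := ltn_ord (p n); lia.
Qed.

Lemma pi_eps_pi_T : p = pi_T (T_eps e).
Proof.
apply/permP => n; apply: val_inj => /=.
have nr := ltn_ord n; have r0 : (0 < r)%N by lia.
case: (cuts_block (T_eps e) nr) => k kT kn.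
apply: succn_inj; rewrite (pi_TE r0 kT kn).
have kc1 := cutsP (ltnW kT); have kc2 := cutsP kT; have gap := cuts_gap r0 kT.
have cr := cuts_le r0 kT (leqnn _); rewrite cuts_last in cr.
move: (nth _ _ k) (nth _ _ k.+1) kn kc1 kc2 gap cr => a b /andP[an nb] ha hb gap br.
have blk (i : 'I_r) : (a <= p i < b)%N = (a <= i < b)%N.
  by rewrite (pi_eps_seg i hb) ![(a <= _)%N]leqNgt (pi_eps_seg i ha).
have ar : (a < r)%N by lia.
have br' : (b.-1 < r)%N by lia.
pose oa := Ordinal ar; pose ob := Ordinal br'.
have cst (i : nat) (ir : (i < r)%N) : (a <= i < b)%N ->
    val e (Ordinal ir) = val e oa.
  elim: i ir => [|i IH] ir hi.
    by congr (val e _); apply: val_inj => /=; lia.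
  case: (eqVneq a i.+1) => [ai|/eqP ai].
    by congr (val e _); apply: val_inj.
  have ir' : (i < r)%N by lia.
  have ir1 : (i < r.-1)%N by lia.
  have : Ordinal ir1 \notin T_eps e by apply: gap => /=; lia.
  rewrite inE -leNgt.
  have -> : ix (Ordinal ir1) = Ordinal ir' by apply: val_inj.
  have -> : ix_succ (Ordinal ir1) = Ordinal ir by apply: val_inj.
  have := @calE_mono _ e (Ordinal ir') (Ordinal ir) (leqnSn _).
  by rewrite IH; last lia; lia.
have en : val e n = val e oa.
  by rewrite -(cst n nr) ?an //; congr (val e _); apply: val_inj.
have eb : val e ob = val e oa by apply: cst; lia.
have := blk oa; have := blk ob; have := pi_epsE e oa; have := pi_epsE e ob.
by have := pi_epsE e n; rewrite eb en /=; lia.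
Qed.

End PiEps.

Lemma pi_T_Pi (r : nat) (T : calT r) : pi_T T \in Pi_set r.
Proof. exact: imset_f. Qed.

Lemma pi_eps_Pi (r : nat) (e : calE r) : pi_eps e \in Pi_set r.
Proof. by rewrite pi_eps_pi_T pi_T_Pi. Qed.

Definition Phi_ET (r : nat) : calE r -> calT r := @T_eps r.

Definition Phi_TPi (r : nat) (T : calT r) : Pi r := Sub (pi_T T) (pi_T_Pi T).

Definition Phi_EPi (r : nat) (e : calE r) : Pi r :=
  Sub (pi_eps e) (pi_eps_Pi e).

(* Main.v *)
(* The permutation pi_T reverses each block between consecutive cuts, so it is
   an involution, and it descends by exactly one at t if t lies outside T and
   ascends at t if t lies in T; hence pi_T determines T. The same dichotomy
   shows that n + pi_T n is nondecreasing in n, so that solving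
   pi_eps n = pi_T n for eps gives an element of calE, which inverts T_eps. *)
Require Import Defs.
From mathcomp Require Import all_boot all_order all_algebra all_fingroup.
From mathcomp Require Import zify.

Set Implicit Arguments.
Unset Strict Implicit.
Unset Printing Implicit Defensive.

Import GRing.Theory.

Local Open Scope ring_scope.

(** Here [t.+1] is an interior cut, so the two points lie in consecutive blocks, and each block is
    mapped into itself. *)
Lemma pi_T_asc (r : nat) (T : calT r) (t : 'I_r.-1) :
  t \in T -> (pi_T T (ix t) < pi_T T (ix_succ t))%N.
Proof.
move=> tT; have tr := ix_succ_subproof t; have r0 : (0 < r)%N by lia.
have tc : t.+1 \in cuts T.
  by rewrite inE mem_rcons inE; apply/or3P/Or33/map_f; rewrite mem_enum.
have := nth_index 0%N tc; have := tc; rewrite -index_mem size_cuts ltnS.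
(* Index 0 is excluded since the initial cut is 0; the last index is excluded next, since the final
   cut [r] exceeds [t.+1]. Hence a block lies on either side. *)
case: (index _ _) => [//|m] mT cm.
have mT' : (m.+1 < #|T|.+1)%N.
  rewrite ltn_neqAle mT andbT; apply/eqP => em.
  by move: cm; rewrite em cuts_last; lia.
have lo := cutsS r0 mT; have hi := cutsS r0 mT'; rewrite cm in lo hi.
have b1 : (nth 0%N (cuts T) m <= ix t < nth 0%N (cuts T) m.+1)%N.
  by rewrite cm /=; lia.
have b2 : (nth 0%N (cuts T) m.+1 <= ix_succ t < nth 0%N (cuts T) m.+2)%N.
  by rewrite cm leqnn.
have := pi_TE r0 mT b1; have := pi_TE r0 mT' b2; rewrite cm.
have -> : ix t = t :> nat by [].
have -> : ix_succ t = t.+1 :> nat by [].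
lia.
Qed.

(** No cut separates the two points, so they share a block, on which point plus image is
    constant. *)
Lemma pi_T_desc (r : nat) (T : calT r) (t : 'I_r.-1) :
  t \notin T -> pi_T T (ix t) = (pi_T T (ix_succ t)).+1 :> nat.
Proof.
move=> tT; have tr := ix_succ_subproof t; have r0 : (0 < r)%N by lia.
have [k kT kt] := cuts_block T (ltnW tr).
have ck : nth 0%N (cuts T) k.+1 <> t.+1.
  move=> ck; case: (cutsP kT) => [||[t' t'T]]; rewrite ck => // e; first lia.
  by case: e => /val_inj e; rewrite e t'T in tT.
have b1 : (nth 0%N (cuts T) k <= ix t < nth 0%N (cuts T) k.+1)%N by [].
have b2 : (nth 0%N (cuts T) k <= ix_succ t < nth 0%N (cuts T) k.+1)%N.
  by move: kt ck => /=; lia.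
have := pi_TE r0 kT b1; have := pi_TE r0 kT b2.
have -> : ix t = t :> nat by [].
have -> : ix_succ t = t.+1 :> nat by [].
lia.
Qed.

Lemma pi_T_inj (r : nat) : injective (@pi_T r).
Proof.
move=> S T eST; apply/setP => t.
case: (boolP (t \in S)) => tS; case: (boolP (t \in T)) => tT //.
- by have := pi_T_asc tS; have := pi_T_desc tT; rewrite eST; lia.
- by have := pi_T_asc tT; have := pi_T_desc tS; rewrite eST; lia.
Qed.

Lemma pi_T_invol (r : nat) (T : calT r) : (pi_T T ^+ 2 = 1)%g.
Proof.
apply/permP => n; rewrite expgS expg1 permM perm1; apply: val_inj => /=.
have nr := ltn_ord n; have r0 : (0 < r)%N by lia.
have [k kT kn] := cuts_block T nr; have pn := pi_TE r0 kT kn.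
(* The image stays in block [k], so the same reversal formula applies a second time. *)
have kpn : (nth 0%N (cuts T) k <= pi_T T n < nth 0%N (cuts T) k.+1)%N by lia.
by have := pi_TE r0 kT kpn; lia.
Qed.

Lemma pi_T_eq1 (r : nat) (T : calT r) :
  pi_T T = 1%g <-> T = [set: 'I_r.-1].
Proof.
split=> [p1 | T1].
  apply/setP => t; rewrite inE; apply/negPn/negP => /pi_T_desc.
  by rewrite p1 !perm1 /=; lia.
apply/permP => n; rewrite perm1; apply: val_inj => /=.
have nr := ltn_ord n; have r0 : (0 < r)%N by lia.
have [k kT kn] := cuts_block T nr; have pn := pi_TE r0 kT kn.
have := cuts_le r0 kT (leqnn _); rewrite cuts_last => kr.
(* A block of length one fixes its point. A longer block would make its first point an element of
   ['I_r.-1] outside [T]. *)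
case: (ltnP (nth 0%N (cuts T) k).+1 (nth 0%N (cuts T) k.+1)) => [gap|];
  last lia.
have cr : (nth 0%N (cuts T) k < r.-1)%N by lia.
have /negP[] := @cuts_gap _ _ r0 _ (Ordinal cr) kT (leqnn _) gap.
by move: (Ordinal cr) => t; rewrite T1 inE.
Qed.

(** A step from t to t + 1 keeps the sum when t is outside [T] and raises it by at least two
    otherwise. *)
Lemma pi_T_add_mono (r : nat) (T : calT r) (i j : 'I_r) :
  (i <= j)%N -> (i + pi_T T i <= j + pi_T T j)%N.
Proof.
case: j => j jr /=; elim: j jr => [|j IH] jr.
  by rewrite leqn0 => /eqP i0; rewrite (_ : i = Ordinal jr) //; apply: val_inj.
rewrite leq_eqVlt => /orP[/eqP ij|ij].
  by rewrite (_ : i = Ordinal jr) //; apply: val_inj.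
have jr' : (j < r)%N by lia.
have jr1 : (j < r.-1)%N by lia.
apply: leq_trans (IH jr' ij) _.
have := @pi_T_asc _ T (Ordinal jr1); have := @pi_T_desc _ T (Ordinal jr1).
have -> : ix (Ordinal jr1) = Ordinal jr' by apply: val_inj.
have -> : ix_succ (Ordinal jr1) = Ordinal jr by apply: val_inj.
by case: (Ordinal jr1 \in T) => [_ /(_ isT)|/(_ isT) + _]; lia.
Qed.

Definition eps_fun (r : nat) (T : calT r) : {ffun 'I_r -> int} :=
  [ffun n : 'I_r => r%:Z + 1 - (n.+1)%:Z - ((pi_T T n).+1)%:Z].

Lemma is_epsilon_eps_fun (r : nat) (T : calT r) : is_epsilon (eps_fun T).
Proof.
apply/and3P; split.
- apply/forallP => i; apply/forallP => j; apply/implyP => ij.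
  by rewrite !ffunE; have := pi_T_add_mono T ij; lia.
(* The difference of the entries is j - i plus the difference of the images at j and i, so the
   forbidden value would contradict injectivity. *)
- apply/forallP => i; apply/forallP => j; apply/implyP => ij; rewrite !ffunE.
  have : pi_T T i <> pi_T T j :> nat.
    by move=> /val_inj/perm_inj e; rewrite e ltnn in ij.
  lia.
- by apply/forallP => n; rewrite ffunE; have := ltn_ord (pi_T T n); lia.
Qed.

Definition eps_T (r : nat) (T : calT r) : calE r :=
  Sub (eps_fun T) (is_epsilon_eps_fun T).

Lemma pi_eps_T (r : nat) (T : calT r) : pi_eps (eps_T T) = pi_T T.
Proof.
apply/permP => n; apply: val_inj => /=.
by have := pi_epsE (eps_T T) n; rewrite /= ffunE; lia.
Qed.

Lemma pi_eps_inj (r : nat) : injective (@pi_eps r).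
Proof.
move=> e f ef; apply: val_inj; apply/ffunP => n.
by have := pi_epsE e n; rewrite ef pi_epsE => /addrI/oppr_inj.
Qed.

Lemma eps_TK (r : nat) : cancel (@eps_T r) (@T_eps r).
Proof. by move=> T; apply: pi_T_inj; rewrite -pi_eps_pi_T pi_eps_T. Qed.

Lemma T_epsK (r : nat) : cancel (@T_eps r) (@eps_T r).
Proof. by move=> e; apply: pi_eps_inj; rewrite pi_eps_T -pi_eps_pi_T. Qed.

Lemma Phi_TPi_bij (r : nat) : bijective (@Phi_TPi r).
Proof.
(* Stated with a boolean equality so that [xchoose] can pick the preimage. *)
have ex (p : Pi r) : exists T, pi_T T == val p.
  by case/imsetP: (valP p) => T _ ->; exists T.
exists (fun p => xchoose (ex p)) => [T | p].
  by apply: pi_T_inj; apply/eqP; exact: (xchooseP (ex (Phi_TPi T))).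
by apply: val_inj; apply/eqP; exact: (xchooseP (ex p)).
Qed.

(** This factorisation yields both the bijectivity of [Phi_EPi] and the composition identity. *)
Lemma Phi_ETPi (r : nat) (e : calE r) : Phi_TPi (Phi_ET e) = Phi_EPi e.
Proof. by apply: val_inj; rewrite /= pi_eps_pi_T. Qed.

Theorem theorem3p3 (r : nat) (r_gt0 : (0 < r)%N) :
  [/\ bijective (@Phi_ET r),
      bijective (@Phi_TPi r) &
      bijective (@Phi_EPi r)]
  /\ (forall Phi_PiE : Pi r -> calE r,
        cancel (@Phi_EPi r) Phi_PiE -> cancel Phi_PiE (@Phi_EPi r) ->
        forall e : calE r, Phi_PiE (Phi_TPi (Phi_ET e)) = e)
  /\ (forall T : calT r,
        (pi_T T ^+ 2 = 1)%g /\ (pi_T T = 1%g <-> T = [set: 'I_r.-1]))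
  /\ (forall e : calE r,
        (pi_eps e ^+ 2 = 1)%g /\
        (pi_eps e = 1%g <->
         forall n : 'I_r, val e n = r%:Z + 1 - (2 * n.+1)%:Z)).
Proof.
have ETbij : bijective (@Phi_ET r).
  by exists (@eps_T r); [exact: T_epsK | exact: eps_TK].
split; last split; last split.
- split=> //; first exact: Phi_TPi_bij.
  exact: eq_bij (bij_comp (Phi_TPi_bij r) ETbij) _ (@Phi_ETPi r).
- by move=> Phi_PiE PhiK _ e; rewrite Phi_ETPi PhiK.
- by move=> T; split; [exact: pi_T_invol | exact: pi_T_eq1].
- move=> e; split; first by rewrite pi_eps_pi_T pi_T_invol.
  split=> [p1 n | en].
    (* With n fixed, the defining formula of [pi_eps] reads n = r + 1 - n - eps_n in 1-based
       indices. *)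
    by have := pi_epsE e n; rewrite p1 perm1; lia.
  apply/permP => n; rewrite perm1; apply: val_inj => /=.
  by have := pi_epsE e n; rewrite en; lia.
Qed.
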